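(* Let $X$ be an infinite-dimensional complex Banach space and let $T\in\mathcal{B}(X)$. The following statements are equivalent: (i) $T$ satisfies property $(Z_{E_a})$; (ii) $T$ satisfies property $(Z_{\Pi_a})$ and $E_a(T)=\Pi_a(T)$; (iii) $T$ satisfies property $(k)$ and $E_a(T)=E(T)$.
   Context: $\mathcal{B}(X)$ is the algebra of bounded linear operators on $X$ and $I$ is the identity. For $S\in\mathcal{B}(X)$, $\mathcal{N}(S)$ and $\mathcal{R}(S)$ are its null space and range, $\sigma(S)$ its spectrum, and $\sigma_a(S)$ its approximate point spectrum ($\lambda\in\sigma_a(S)$ iff $S-\lambda I$ is not bounded below). $S\in\mathcal{B}(X)$ is Fredholm if $\dim\mathcal{N}(S)<\infty$ and $\operatorname{codim}\mathcal{R}(S)<\infty$, with index $\dim\mathcal{N}(S)-\operatorname{codim}\mathcal{R}(S)$; it is Weyl if it is Fredholm of index $0$. The Weyl spectrum is $\sigma_W(T)=\{\lambda\in\mathbb{C}: T-\lambda I \text{ is not Weyl}\}$. The ascent of $S$ is $a(S)=\inf\{n\in\mathbb{N}:\mathcal{N}(S^n)=\mathcal{N}(S^{n+1})\}$, with $\mathbb{N}=\{0,1,2,\dots\}$ and $\inf\emptyset=\infty$. $\lambda\in\sigma_a(T)$ is a left pole of $T$ if $a(T-\lambda I)<\infty$ and $\mathcal{R}((T-\lambda I)^{a(T-\lambda I)+1})$ is closed. $\Pi_a(T)$ is the set of left poles of $T$. $\mathrm{iso}\,A$ denotes the set of isolated points of $A\subset\mathbb{C}$ and $\sigma_p(T)$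 the set of eigenvalues of $T$. Put $E(T)=\mathrm{iso}\,\sigma(T)\cap\sigma_p(T)$ and $E_a(T)=\mathrm{iso}\,\sigma_a(T)\cap\sigma_p(T)$. $T$ satisfies: property $(Z_{E_a})$ if $\sigma(T)\setminus\sigma_W(T)=E_a(T)$; property $(Z_{\Pi_a})$ if $\sigma(T)\setminus\sigma_W(T)=\Pi_a(T)$; property $(k)$ if $\sigma(T)\setminus\sigma_W(T)=E(T)$. *)

(* Defs.v *)
From HB Require Import structures.
From mathcomp Require Import all_boot all_order all_algebra.
From mathcomp Require Import complex.
From mathcomp Require Import all_classical all_reals all_analysis.

Set Implicit Arguments.
Unset Strict Implicit.
Unset Printing Implicit Defensive.

Import Order.TTheory GRing.Theory Num.Theory.
Import numFieldNormedType.Exports.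

Local Open Scope classical_set_scope.
Local Open Scope ring_scope.
Local Open Scope complex_scope.

(* Norms of vectors of a normed module over [R[i]] are elements of [R[i]],
   and an inequality [a <= b] in [R[i]] includes [Im a = Im b]; in particular
   [0 < c] forces [c] to be a positive real number. *)

Section Dimension.
Variables (R : realType) (X : lmodType R[i]).
Implicit Type V : set X.

(* In the next two definitions, [V] is meant to be a linear subspace of [X]. *)

Definition has_dim V (n : nat) : Prop :=
  exists2 b : 'I_n -> X, (forall i, V (b i)) &
    forall x, V x -> exists! c : {ffun 'I_n -> R[i]}, x = \sum_i c i *: b i.

(* The classes modulo [V] of the vectors [b i] form a basis of [X / V]. *)
Definition has_codim V (n : nat) : Prop :=
  exists b : 'I_n -> X,
    forall x, exists! c : {ffun 'I_n -> R[i]}, V (x - \sum_i c i *: b i).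

Definition finite_dim V : Prop := exists n, has_dim V n.
Definition finite_codim V : Prop := exists n, has_codim V n.

(* The value is 0 when the dimension or codimension is infinite. *)
Definition dim V : nat := xget 0%N [set n | has_dim V n].
Definition codim V : nat := xget 0%N [set n | has_codim V n].

End Dimension.

Section Operators.
Variables (R : realType) (X : completeNormedModType R[i]).
Implicit Types (S T : {linear X -> X}) (lambda : R[i]).

Definition bounded_op S : Prop := exists M : R[i], forall x, `|S x| <= M * `|x|.

Definition null_space (f : X -> X) : set X := [set x | f x = 0].

Definition invertible_op S : Prop :=
  exists S' : {linear X -> X}, [/\ bounded_op S', cancel S S' & cancel S' S].

Definition bounded_below S : Prop :=
  exists2 c : R[i], 0 < c & forall x, c * `|x| <= `|S x|.

Definition fredholm S : Prop :=
  finite_dim (null_space S) /\ finite_codim (range S).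

Definition fredholm_index S : int :=
  (dim (null_space S))%:Z - (codim (range S))%:Z.

Definition weyl S : Prop := fredholm S /\ fredholm_index S = 0.

(* [None] stands for an infinite ascent. *)
Definition ascent S : option nat :=
  if pselect (exists n, `[< null_space (iter n S) = null_space (iter n.+1 S) >])
  is left exn then Some (ex_minn exn) else None.

Definition shift_op T lambda : {linear X -> X} := T \- lambda \*: idfun.

Definition spectrum T : set R[i] :=
  [set lambda | ~ invertible_op (shift_op T lambda)].

Definition approx_point_spectrum T : set R[i] :=
  [set lambda | ~ bounded_below (shift_op T lambda)].

Definition point_spectrum T : set R[i] :=
  [set lambda | exists2 x : X, x != 0 & T x = lambda *: x].

Definition weyl_spectrum T : set R[i] :=
  [set lambda | ~ weyl (shift_op T lambda)].

Definition left_poles T : set R[i] :=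
  [set lambda | approx_point_spectrum T lambda /\
    exists2 p, ascent (shift_op T lambda) = Some p &
      closed (range (iter p.+1 (shift_op T lambda)))].

(* [R[i]^o] is [R[i]] with the topology given by the modulus. *)
Definition iso (A : set R[i]) : set R[i] := isolated (A : set R[i]^o).

Definition iso_eigenvalues T : set R[i] :=
  iso (spectrum T) `&` point_spectrum T.

Definition iso_approx_eigenvalues T : set R[i] :=
  iso (approx_point_spectrum T) `&` point_spectrum T.

Definition property_ZEa T : Prop :=
  spectrum T `\` weyl_spectrum T = iso_approx_eigenvalues T.

Definition property_ZPia T : Prop :=
  spectrum T `\` weyl_spectrum T = left_poles T.

Definition property_k T : Prop :=
  spectrum T `\` weyl_spectrum T = iso_eigenvalues T.

End Operators.

(* Main.v *)
From HB Require Import structures.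
Require Import Defs.
From mathcomp Require Import all_boot all_order all_algebra.
From mathcomp Require Import complex.
From mathcomp Require Import all_classical all_reals all_analysis.
From mathcomp Require Import ring lra.

Import Order.TTheory GRing.Theory Num.Theory.
Import numFieldNormedType.Exports.
Local Open Scope classical_set_scope.
Local Open Scope ring_scope.
Local Open Scope complex_scope.

Set Implicit Arguments.
Unset Strict Implicit.
Unset Printing Implicit Defensive.

(** Write S for T - lambda.  Two inclusions hold for every bounded operator:
    an eigenvalue isolated in the spectrum is isolated in the smaller
    approximate point spectrum ([iso_eigenvalues_approx]), and a left pole is
    an eigenvalue isolated in the approximate point spectrum
    ([left_poles_iso]).  Each of the three properties equates one of these sets
    with the set of spectral points at which S is Weyl, so what remains is to
    reverse the inclusions at points where S is Weyl.  There the three kinds of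
    points coincide, and finite ascent is the link between them.

    - If S is Weyl and S - mu is injective for all small nonzero mu, then S has
      finite ascent ([isolated_finite_ascent]).  On the intersection M of the
      ranges of the powers of S, the operator S is onto, hence so is S - mu for
      small mu, with preimages bounded independently of mu.  As S - mu is
      injective, it is bounded below on M uniformly in mu; letting mu tend to 0,
      S is injective on M.  Finally the kernel of S inside a high enough range
      lies in M ([kernel_range_stabilizes]).
    - If S is Weyl with finite ascent p, then the restrictions of S to the
      ranges of its powers still have index zero ([index_image]), so the range
      of S^p is mapped onto itself ([range_stationary]), and S - mu is onto for
      small nonzero mu ([weyl_shift_onto]).  It is also bounded below because
      lambda is a left pole ([left_pole_bounded_below]), hence invertible.

    The analytic tool throughout is the open mapping theorem
    ([open_mapping]), which also shows that a range of finite codimension is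
    closed ([closed_image_finite_codim]).  The passage from the range of a power
    of S to the whole space rests on the fact that S^n - mu^n is a multiple of
    S - mu ([power_shift]). *)

(** * Real-valued norms and Cauchy sequences *)

Section RealNorm.
Variable R : realType.

(** The order of R[i] is partial; the real part of a norm lies in a totally
    ordered field and carries the same information. *)
Definition rnorm (V : normedZmodType R[i]) (x : V) : R := complex.Re `|x|.

Section Zmod.
Variable V : normedZmodType R[i].
Implicit Types x y : V.

Lemma rnormE x : (rnorm x)%:C = `|x|.
Proof.
rewrite /rnorm; have := normr_ge0 x; rewrite lecE => /andP[/eqP im _].
by rewrite [RHS]complexE im mulr0 addr0.
Qed.

Lemma rnorm_ge0 x : 0 <= rnorm x.
Proof. by rewrite -lecR rnormE normr_ge0. Qed.

Lemma rnormD x y : rnorm (x + y) <= rnorm x + rnorm y.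
Proof. by rewrite -lecR rmorphD /= !rnormE ler_normD. Qed.

Lemma rnormN x : rnorm (- x) = rnorm x.
Proof. by rewrite /rnorm normrN. Qed.

Lemma rnormB x y : rnorm (x - y) <= rnorm x + rnorm y.
Proof. by rewrite -(rnormN y) rnormD. Qed.

Lemma rnorm_distC x y : rnorm (x - y) = rnorm (y - x).
Proof. by rewrite /rnorm distrC. Qed.

Lemma rnorm0 : rnorm (0 : V) = 0.
Proof. by rewrite /rnorm normr0. Qed.

Lemma rnorm0_eq0 x : rnorm x <= 0 -> x = 0.
Proof.
move=> x0; apply/normr0_eq0/eqP; rewrite -rnormE.
by apply/eqP; congr (_%:C); apply/eqP; rewrite eq_le x0 rnorm_ge0.
Qed.

Lemma rnorm_gt0 x : x != 0 -> 0 < rnorm x.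
Proof. by rewrite ltNge; apply: contraNN => /rnorm0_eq0 ->. Qed.

End Zmod.

Lemma rnormM (a b : R[i]) : rnorm (a * b) = rnorm a * rnorm b.
Proof. by apply: (@complexI R); rewrite rmorphM /= !rnormE normrM. Qed.

Lemma rnormZ (V : normedModType R[i]) a (x : V) :
  rnorm (a *: x) = rnorm a * rnorm x.
Proof. by apply: (@complexI R); rewrite rmorphM /= !rnormE normrZ. Qed.

Lemma rnorm_real (a : R) : rnorm a%:C = `|a|.
Proof. by rewrite /rnorm normc_def /= expr0n addr0 sqrtr_sqr. Qed.

Lemma rnormX (a : R[i]) n : rnorm (a ^+ n) = rnorm a ^+ n.
Proof. by apply: (@complexI R); rewrite rmorphXn /= !rnormE normrX. Qed.

Lemma geom_lt (c e : R) : 0 < e -> exists n, c * 2^-1 ^+ n < e.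
Proof.
move=> e0; have [n cn] : exists n, `|c| / e < n%:R.
  by exists (Num.bound (`|c| / e)); rewrite archi_boundP ?divr_ge0// ltW.
exists n; apply: le_lt_trans (ler_norm _) _.
rewrite normrM normrX (@ger0_norm _ 2^-1) ?invr_ge0 // exprVn ltr_pdivrMr
  ?exprn_gt0 //.
rewrite mulrC -ltr_pdivrMr //; apply: lt_trans cn _.
by rewrite -natrX ltr_nat ltn_expl.
Qed.

Lemma gt0_real (e : R[i]) : 0 < e -> (complex.Re e)%:C = e.
Proof.
by rewrite ltcE => /andP[/eqP im _]; rewrite [RHS]complexE im mulr0 addr0.
Qed.

Lemma closed_rnormP (V : normedModType R[i]) (A : set V) :
  closed A <->
  forall x, (forall e : R, 0 < e -> exists2 a, A a & rnorm (x - a) < e) -> A x.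
Proof.
split=> [clA x xA|clA x xA].
  apply: clA => B /nbhs_ballP[e /= e0 xB].
  have ee := esym (gt0_real e0).
  have [|a Aa xa] := xA (complex.Re e); first by rewrite -ltcR -ee.
  exists a; split=> //; apply: xB; rewrite -ball_normE /= ee -rnormE ltcR //.
apply: clA => e e0; have [|a [Aa xa]] := xA (ball x (e%:C : R[i])).
  by apply: nbhsx_ballx; rewrite ltcR.
by exists a => //; move: xa; rewrite -ball_normE /= -rnormE ltcR.
Qed.

End RealNorm.

(** The field is arbitrary because the lemma serves both for vectors, over R[i],
    and for the real and imaginary parts of scalars, over R. *)
Lemma cauchy_majorant (K : numFieldType) (V : completeNormedModType K)
    (u : nat -> V) (r : nat -> K) :
  (forall n m, (n <= m)%N -> `|u m - u n| <= r n) ->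
  (forall e, 0 < e -> exists n, r n < e) ->
  exists s, forall n, `|s - u n| <= r n.
Proof.
move=> ur r0; have : cvgn u.
  apply/cauchy_cvgP/cauchy_exP => e e0; have [N rN] := r0 _ e0.
  exists (u N); exists N => // m /= Nm; rewrite -ball_normE /=.
  by rewrite distrC (le_lt_trans (ur _ _ Nm)).
move=> /cvg_ex[s us]; exists s => n; apply/ler_addgt0Pr => e e0.
have /cvgrPdist_lt/(_ _ e0)[N _ sN] := us.
have {}sN := sN (maxn N n) (leq_maxl _ _).
rewrite -(subrKA (u (maxn N n))) (le_trans (ler_normD _ _)) // addrC.
by rewrite lerD // ?ur ?leq_maxr // ltW.
Qed.

Section Complete.
Variable R : realType.

(** If every step of [u] costs at most the decrease of the budget [r], then all
    the steps from [n] on cost at most what is left, [r n]. *)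
Lemma telescope_cauchy (V : normedZmodType R[i]) (u : nat -> V) (r : nat -> R) :
  (forall k, rnorm (u k.+1 - u k) <= r k - r k.+1) -> (forall k, 0 <= r k) ->
  forall n m, (n <= m)%N -> rnorm (u m - u n) <= r n.
Proof.
move=> ur r0 n m /subnK <-; move: (m - n)%N => k.
suff : rnorm (u (k + n)%N - u n) <= r n - r (k + n)%N.
  by have := r0 (k + n)%N; lra.
elim: k => [|k ih]; first by rewrite !subrr rnorm0.
rewrite addSn -(subrKA (u (k + n)%N)); apply: le_trans (rnormD _ _) _.
by have := ur (k + n)%N; lra.
Qed.

Lemma telescope_cvg (V : completeNormedModType R[i])
    (u : nat -> V) (r : nat -> R) :
  (forall k, rnorm (u k.+1 - u k) <= r k - r k.+1) -> (forall k, 0 <= r k) ->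
  (forall e, 0 < e -> exists n, r n < e) ->
  exists s, forall n, rnorm (s - u n) <= r n.
Proof.
move=> ur r0 rlim.
have [n m nm|e e0|s us] := @cauchy_majorant _ _ u (fun n => (r n)%:C).
- by rewrite -rnormE lecR telescope_cauchy.
- have := e0; rewrite ltcE => /andP[/eqP /= im /rlim[n rn]].
  by exists n; rewrite ltcE /= im eqxx.
- by exists s => n; rewrite -lecR rnormE.
Qed.

Lemma rnorm_half : rnorm (2^-1 : R[i]) = 2^-1.
Proof.
rewrite -(rmorph_nat (real_complex R)) -fmorphV rnorm_real ger0_norm
  ?invr_ge0//.
Qed.

Lemma rnorm_geRe (c : R[i]) : `|complex.Re c| <= rnorm c.
Proof. by rewrite -lecR rnormE normc_ge_Re. Qed.

Lemma rnorm_i : rnorm ('i%C : R[i]) = 1.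
Proof. by rewrite /rnorm normc_def /= expr0n expr1n add0r sqrtr1. Qed.

Lemma rnorm_geIm (c : R[i]) : `|complex.Im c| <= rnorm c.
Proof.
by have := rnorm_geRe (c * 'i); rewrite ReiNIm normrN rnormM rnorm_i mulr1.
Qed.

Lemma rnorm_ReIm (c : R[i]) : rnorm c <= `|complex.Re c| + `|complex.Im c|.
Proof.
rewrite {1}[c]complexE (le_trans (rnormD _ _)) // rnormM !rnorm_real.
by rewrite rnorm_i mul1r.
Qed.

(** The real and imaginary parts converge separately, each one within [r n] of
    its limit; hence the factor 2. *)
Lemma telescope_cvgC (u : nat -> R[i]) (r : nat -> R) :
  (forall k, rnorm (u k.+1 - u k) <= r k - r k.+1) -> (forall k, 0 <= r k) ->
  (forall e, 0 < e -> exists n, r n < e) ->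
  exists s, forall n, rnorm (s - u n) <= 2 * r n.
Proof.
move=> ur r0 rlim; have uC := telescope_cauchy ur r0.
have [n m nm||a ua] // := @cauchy_majorant R R (fun n => complex.Re (u n)) r.
  by rewrite -raddfB (le_trans (rnorm_geRe _)) ?uC.
have [n m nm||b ub] // := @cauchy_majorant R R (fun n => complex.Im (u n)) r.
  by rewrite -raddfB (le_trans (rnorm_geIm _)) ?uC.
exists (a +i* b) => n; rewrite (le_trans (rnorm_ReIm _)) //.
have := ua n; have := ub n; rewrite !raddfB /=; lra.
Qed.

End Complete.

(** * The open mapping theorem *)

Section Subspaces.
Variable R : realType.

Definition subspace (L : lmodType R[i]) (V : set L) :=
  V 0 /\ forall a x y, V x -> V y -> V (a *: x + y).

Section Subspace.
Variables (L : lmodType R[i]) (V : set L).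
Hypothesis sV : subspace V.

Lemma subspaceD x y : V x -> V y -> V (x + y).
Proof. by move=> Vx Vy; have := sV.2 1 _ _ Vx Vy; rewrite scale1r. Qed.

Lemma subspaceZ a x : V x -> V (a *: x).
Proof. by move=> Vx; have := sV.2 a _ _ Vx sV.1; rewrite addr0. Qed.

Lemma subspaceB x y : V x -> V y -> V (x - y).
Proof.
by move=> Vx Vy; rewrite -scaleN1r; apply: subspaceD => //; exact: subspaceZ.
Qed.

Lemma subspace_sum n (F : 'I_n -> L) : (forall i, V (F i)) -> V (\sum_i F i).
Proof.
move=> VF; elim/big_ind: _ => // [|x y]; first exact: sV.1.
exact: subspaceD.
Qed.

End Subspace.

Lemma subspace_image (L L' : lmodType R[i]) (f : {linear L -> L'}) (V : set L) :
  subspace V -> subspace (f @` V).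
Proof.
move=> [V0 VL]; split=> [|a _ _ [x Vx <-] [y Vy <-]].
  by exists 0; rewrite ?linear0.
by exists (a *: x + y); [exact: VL|rewrite linearP].
Qed.

End Subspaces.

Section OpenMapping.
Variable R : realType.

Definition seminorm (L : lmodType R[i]) (P : L -> R) :=
  (forall x y, P (x + y) <= P x + P y) /\
  forall a x, P (a *: x) = rnorm a * P x.

(** Completeness in the form that the open mapping theorem consumes.  The
    constant [A] has to be the same for all series: it enters the bound on
    preimages. *)
Definition complete_for (L : lmodType R[i]) (P : L -> R) (V : set L) :=
  exists2 A : R, 0 <= A & forall (t : nat -> L) (c : R),
    (forall k, V (t k)) -> (forall k, P (t k) <= c * 2^-1 ^+ k) ->
  exists2 s, V s & forall n, P (s - \sum_(k < n) t k) <= A * c * 2^-1 ^+ n.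

(** The source is only a module with a seminorm, so that the theorem applies to
    closed subspaces of X as well as to their products with a space of row
    vectors.  Closedness of the image stands for completeness of the target. *)
Variables (Z : lmodType R[i]) (X : completeNormedModType R[i]).
Variables (f : {linear Z -> X}) (P : Z -> R) (V : set Z) (K : R).
Hypotheses (sV : subspace V) (semP : seminorm P) (cV : complete_for P V).
Hypotheses (K0 : 0 <= K) (fK : forall z, rnorm (f z) <= K * P z).
Hypothesis clU : closed (f @` V).

Let U := f @` V.

Let P0 : P 0 = 0.
Proof. by have := semP.2 0 0; rewrite scale0r rnorm0 mul0r. Qed.

Let PN x : P (- x) = P x.
Proof. by rewrite -scaleN1r semP.2 /rnorm normrN normr1 mul1r. Qed.

Let Pge0 x : 0 <= P x.
Proof. by have := semP.1 x (- x); rewrite subrr P0 PN; lra. Qed.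

(** Baire's argument.  Otherwise there are nested balls, centred in [U], such
    that the (n+1)-st one stays away from the image of the ball of radius [n].
    Their common point belongs to [U], but is the image of no vector of [V]. *)
Lemma image_ball_dense_somewhere : exists (n : nat) u0 (r : R),
  [/\ U u0, 0 < r &
  forall u, U u -> rnorm (u - u0) < r -> forall e, 0 < e ->
    exists v, [/\ V v, P v <= n%:R & rnorm (u - f v) < e]].
Proof.
apply: contrapT => nodense.
have step (p : nat * (X * R)) : exists q : X * R, U p.2.1 -> 0 < p.2.2 ->
    [/\ U q.1, 0 < q.2, rnorm (q.1 - p.2.1) <= p.2.2 - q.2, q.2 <= p.2.2 / 2 &
     forall v, V v -> P v <= p.1%:R -> q.2 < rnorm (q.1 - f v)].
  case: p => n [u r] /=; have [Uu|nUu] := pselect (U u); last by exists (0, 0).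
  have [r0|r0] := ltrP 0 r; last by exists (0, 0) => _; lra.
  apply: contrapT => nq; apply: nodense; exists n, u, (r / 2); split=> //.
    by rewrite divr_gt0.
  move=> u' Uu' u'u e e0; apply: contrapT => nv; apply: nq.
  (* All approximants of [u'] have error at least [e]; a radius at most [e / 2]
     extends this to the whole next ball. *)
  exists (u', Num.min (r / 2) (e / 2)) => _ _; split=> //=.
  - by rewrite lt_min !divr_gt0.
  - have : Num.min (r / 2) (e / 2) <= r / 2 by rewrite ge_min lexx.
    by lra.
  - by rewrite ge_min lexx.
  - move=> v Vv Pv; apply: (@lt_le_trans _ _ e); last first.
      by rewrite leNgt; apply/negP => lte; apply: nv; exists v.
    by rewrite gt_min; apply/orP; right; lra.
have [g gP] := choice step.
pose s := fix s n := if n is m.+1 then g (m, s m) else (0 : X, 1 : R).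
have sU n : U (s n).1 /\ 0 < (s n).2.
  elim: n => [|n [Un rn]] /=; first by split; [exists 0; rewrite ?linear0 //;
    exact: sV.1|].
  by have [] := gP (n, s n) Un rn.
have sP n := gP (n, s n) (sU n).1 (sU n).2.
have s2 n : (s n).2 <= 1 * 2^-1 ^+ n.
  elim: n => [|n ih]; first by rewrite expr0 mulr1.
  by have [_ _ _ h _] := sP n; move: h => /= h; rewrite exprS; lra.
have [n|||l lP] := @telescope_cvg R X (fun n => (s n).1) (fun n => (s n).2).
- by have [] := sP n.
- by move=> n; rewrite ltW // (sU n).2.
- by move=> e e0; have [n ne] := geom_lt 1 e0; exists n;
  exact: le_lt_trans (s2 n) ne.
have [v Vv fv] : U l.
  move/closed_rnormP: clU; apply=> e e0; have [n ne] := geom_lt 1 e0.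
  exists (s n).1; first exact: (sU n).1.
  by rewrite (le_lt_trans (lP n)) // (le_lt_trans (s2 n)).
have : P v <= (Num.bound (P v))%:R by rewrite ltW // archi_boundP.
set n := Num.bound _ => Pv; have [_ _ _ _ /(_ v Vv Pv)] := sP n.
by have := lP n.+1; rewrite /= fv rnorm_distC; lra.
Qed.

(** A vector [u] is the difference of [u + u0] and [u0], which moves the centre
    of the ball to 0. *)
Lemma image_ball_dense : exists (c r : R), [/\ 0 < c, 0 < r &
  forall u, U u -> rnorm u < r -> forall e, 0 < e ->
    exists v, [/\ V v, P v <= c & rnorm (u - f v) < e]].
Proof.
have [n [u0 [r [Uu0 r0 dense]]]] := image_ball_dense_somewhere.
exists (n%:R + n%:R + 1), r; split=> //.
move=> u Uu ur e e0; have e20 : 0 < e / 2 by lra.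
have [||v [Vv Pv ve]] := dense (u + u0) _ _ _ e20.
  by apply: subspaceD => //; exact: subspace_image.
  by rewrite addrK.
have [|w [Vw Pw we]] := dense u0 Uu0 _ _ e20; first by rewrite subrr rnorm0.
exists (v - w); split; first exact: subspaceB.
  by have := semP.1 v (- w); rewrite PN; move: Pv Pw; set N := n%:R; lra.
rewrite linearB (_ : u - _ = (u + u0 - f v) - (u0 - f w)); last first.
  by rewrite !opprB -{1}[u](addrK u0) [LHS]addrACA [RHS]addrACA (addrC (- f v)).
by have := rnormB (u + u0 - f v) (u0 - f w); lra.
Qed.

(** Successive approximation: an error below [r / 2] is doubled and approximated
    again, so that [u] is the image of a geometrically dominated series. *)
Lemma open_mapping_ball : exists (C r : R), [/\ 0 <= C, 0 < r &
  forall u, U u -> rnorm u < r -> exists v, [/\ V v, f v = u & P v <= C]].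
Proof.
have [c [r [c0 r0 dense]]] := image_ball_dense.
have r20 : 0 < r / 2 by lra.
have /choice[g gP] : forall u, exists v, U u -> rnorm u < r ->
    [/\ V v, P v <= c & rnorm (u - f v) < r / 2].
  move=> u; have [Uu|nUu] := pselect (U u); last by exists 0.
  have [ur|ur] := ltrP (rnorm u) r; last by exists 0.
  by have [v vP] := dense u Uu ur _ r20; exists v => _ _.
pose us u := fix us n := if n is m.+1 then 2 *: (us m - f (g (us m))) else u :
  X.
have [A A0 cVA] := cV.
exists (A * c), r; split=> // [|u Uu ur]; first by rewrite mulr_ge0 // ltW.
have usU n : U (us u n) /\ rnorm (us u n) < r.
  elim: n => [//|n [Un rn]] /=; have [Vg _ gr] := gP _ Un rn; split.
    apply: subspaceZ; first exact: subspace_image.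
    by apply: subspaceB => //; [exact: subspace_image|exists (g (us u n))].
  by rewrite rnormZ -(rmorph_nat (real_complex R)) rnorm_real normr_nat; lra.
have usP n := gP _ (usU n).1 (usU n).2.
pose t k := (2^-1 ^+ k : R[i]) *: g (us u k).
have tV k : V (t k) by apply: subspaceZ => //; have [] := usP k.
have tP k : P (t k) <= c * 2^-1 ^+ k.
  rewrite semP.2 rnormX rnorm_half mulrC ler_wpM2r ?exprn_ge0 ?invr_ge0 //.
  by have [] := usP k.
have [s Vs sA] := cVA _ _ tV tP.
have sumP n : u - f (\sum_(k < n) t k) = (2^-1 ^+ n : R[i]) *: us u n.
  elim: n => [|n ih]; first by rewrite big_ord0 linear0 subr0 scale1r.
  rewrite big_ord_recr /= linearD opprD addrA ih linearZ -scalerBr exprSr.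
  by rewrite [RHS]scalerA -mulrA mulVf ?pnatr_eq0 // mulr1.
exists s; split=> //; last by have := sA 0%N; rewrite big_ord0 subr0 mulr1.
apply/eqP; rewrite -subr_eq0; apply/eqP/rnorm0_eq0; rewrite leNgt; apply/negP.
move=> /(geom_lt (K * (A * c) + r))[n].
have := fK (s - \sum_(k < n) t k); have := sA n; have [_ usr] := usU n.
rewrite linearB /= => sAn fKn; rewrite -(subrKA (f (\sum_(k < n) t k))).
have := rnormB (f s - f (\sum_(k < n) t k)) (u - f (\sum_(k < n) t k)).
rewrite opprB sumP rnormZ rnormX rnorm_half => le1.
have := ler_wpM2l K0 sAn;
  have h0 : 0 <= 2^-1 ^+ n :> R by rewrite exprn_ge0 ?invr_ge0.
have := ler_wpM2l h0 (ltW usr); lra.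
Qed.

(** Any nonzero [f v] has a multiple of norm [r / 2], to which the previous
    lemma applies; the vector found is scaled back. *)
Lemma open_mapping : exists2 C : R, 0 < C &
  forall v, V v -> exists v', [/\ V v', f v' = f v & P v' <= C * rnorm (f v)].
Proof.
have [C [r [C0 r0 ball]]] := open_mapping_ball.
exists (2 * C / r + 1); first by have := divr_ge0 C0 (ltW r0); lra.
move=> v Vv; have [/eqP fv0|fv0] := boolP (f v == 0).
  by exists 0; split; [exact: sV.1|rewrite linear0 fv0|rewrite P0 fv0 rnorm0
    mulr0].
have fv_gt0 := rnorm_gt0 fv0.
pose a : R := r / 2 / rnorm (f v).
have a0 : 0 < a by rewrite !divr_gt0.
have aC : (a%:C)%C != 0 :> R[i] by rewrite (inj_eq (@complexI R) _ 0) gt_eqF.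
have [|| w [Vw fw Pw]] := ball (a%:C *: f v).
- by apply: subspaceZ; [exact: subspace_image|exists v].
- by rewrite rnormZ rnorm_real gtr0_norm // /a divfK ?gt_eqF //; lra.
exists ((a^-1)%:C *: w); split; first exact: subspaceZ.
  by rewrite linearZ /= fw scalerA fmorphV mulVf // scale1r.
rewrite semP.2 rnorm_real gtr0_norm ?invr_gt0 // /a !invf_div.
rewrite [leRHS]mulrDl mul1r; apply: (@le_trans _ _ (rnorm (f v) * (2 / r) * C)).
  by rewrite ler_wpM2l // mulr_ge0 ?divr_ge0 ?ltW.
have -> : rnorm (f v) * (2 / r) * C = 2 * C / r * rnorm (f v) by ring.
by rewrite lerDl rnorm_ge0.
Qed.

End OpenMapping.

(** * Images of finite codimension are closed *)

Section ClosedRange.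
Variables (R : realType) (X : completeNormedModType R[i]).

Lemma bounded_opP (S : {linear X -> X}) :
  bounded_op S -> exists2 K : R, 0 < K & forall x, rnorm (S x) <= K * rnorm x.
Proof.
move=> [M SM]; exists (rnorm M + 1); first by have := rnorm_ge0 M; lra.
move=> x; apply: (@le_trans _ _ (rnorm M * rnorm x)).
  rewrite -lecR rmorphM /= !rnormE (le_trans (SM x)) //.
  by rewrite -[leLHS]ger0_norm ?(le_trans _ (SM x)) // normrM normr_id.
by rewrite ler_wpM2r ?rnorm_ge0 // lerDl.
Qed.

Lemma seminorm_rnorm : seminorm (@rnorm R X).
Proof. by split; [exact: rnormD|exact: rnormZ]. Qed.

Lemma rnorm_sum (V : normedZmodType R[i]) n (F : 'I_n -> V) :
  rnorm (\sum_i F i) <= \sum_i rnorm (F i).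
Proof.
elim/big_rec2: _ => [|i y x _ xy]; first by rewrite rnorm0.
by rewrite (le_trans (rnormD _ _)) // lerD2l.
Qed.

(** The tail of the geometric series, as a budget for [telescope_cvg]. *)
Lemma geom_radius (c : R) k :
  c * 2^-1 ^+ k = 2 * c * 2^-1 ^+ k - 2 * c * 2^-1 ^+ k.+1.
Proof. by rewrite exprS; lra. Qed.

Lemma complete_closed (V : set X) :
  subspace V -> closed V -> complete_for (@rnorm R X) V.
Proof.
move=> sV clV; exists 2 => // t c tV tc.
have c0 : 0 <= c by have := tc 0%N; rewrite mulr1; exact/le_trans/rnorm_ge0.
have h0 k : 0 <= 2 * c * 2^-1 ^+ k by rewrite !mulr_ge0 ?exprn_ge0 ?invr_ge0.
pose u n := \sum_(k < n) t k.
have [k||e e0|s us] := @telescope_cvg R X u (fun n => 2 * c * 2^-1 ^+ n).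
- by rewrite -geom_radius /u big_ord_recr /= addrAC subrr add0r.
- exact: h0.
- exact: geom_lt.
exists s => //; move/closed_rnormP: clV; apply=> e /(geom_lt (2 * c))[n ne].
exists (u n); first exact: subspace_sum.
exact: le_lt_trans (us n) ne.
Qed.

Lemma complete_scalars (t : nat -> R[i]) (c : R) :
  (forall k, rnorm (t k) <= c * 2^-1 ^+ k) ->
  exists s, forall n, rnorm (s - \sum_(k < n) t k) <= 4 * c * 2^-1 ^+ n.
Proof.
move=> tc.
have c0 : 0 <= c by have := tc 0%N; rewrite mulr1; exact/le_trans/rnorm_ge0.
have h0 k : 0 <= 2 * c * 2^-1 ^+ k by rewrite !mulr_ge0 ?exprn_ge0 ?invr_ge0.
have [k||e e0|s us] := @telescope_cvgC R (fun n => \sum_(k < n) t k)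
    (fun n => 2 * c * 2^-1 ^+ n).
- by rewrite -geom_radius big_ord_recr /= addrAC subrr add0r.
- exact: h0.
- exact: geom_lt.
by exists s => n; rewrite (le_trans (us n)) // !mulrA -natrM.
Qed.

Section Product.
Variable n : nat.
Let Z := (X * 'rV[R[i]]_n)%type.

Definition prod_seminorm (z : Z) : R := rnorm z.1 + \sum_i rnorm (z.2 0 i).

Lemma prod_seminormP : seminorm (prod_seminorm : Z -> R).
Proof.
split=> [x y|a x]; rewrite /prod_seminorm /=.
  rewrite addrACA lerD ?rnormD // -big_split ler_sum // => i _.
  by rewrite mxE rnormD.
rewrite rnormZ mulrDr mulr_sumr; congr (_ + _).
by apply: eq_bigr => i _; rewrite mxE rnormM.
Qed.

Lemma complete_prod (V : set X) : subspace V -> closed V ->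
  complete_for (prod_seminorm : Z -> R) [set z : Z | V z.1].
Proof.
move=> sV clV; have [A A0 cV] := complete_closed sV clV.
exists (A + 4 *+ n); first by rewrite addr_ge0 // mulrn_wge0.
move=> t c tV tc.
have sum_ge0 (z : Z) : 0 <= \sum_i rnorm (z.2 0 i).
  by rewrite sumr_ge0 // => i _; exact: rnorm_ge0.
have [|s Vs sA] := cV (fun k => (t k).1) c tV.
  by move=> k; have := tc k; have := sum_ge0 (t k); rewrite /prod_seminorm; lra.
have /choice[d dP] : forall i, exists d, forall m,
    rnorm (d - \sum_(k < m) (t k).2 0 i) <= 4 * c * 2^-1 ^+ m.
  move=> i; apply: (@complete_scalars (fun k => (t k).2 0 i)) => k;
    have := tc k.
  rewrite /prod_seminorm (bigD1 i) //=; set s' := \sum_(j | _) _.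
  have : 0 <= s' by rewrite sumr_ge0 // => j _; exact: rnorm_ge0.
  by have := rnorm_ge0 (t k).1; lra.
exists (s, \row_i d i) => // m; rewrite /prod_seminorm /=.
rewrite !mulrDl lerD //.
  by rewrite (raddf_sum (@fst X 'rV[R[i]]_n)) sA.
apply: (@le_trans _ _ (\sum_(i < n) 4 * c * 2^-1 ^+ m)).
  apply: ler_sum => i _;
    rewrite mxE [in X in rnorm X]mxE (raddf_sum (@snd X 'rV[R[i]]_n)).
  by rewrite mxE summxE; exact: dP.
by rewrite sumr_const card_ord -!mulrnAl.
Qed.

End Product.

Lemma row_linear_bound n (b : {linear 'rV[R[i]]_n -> X}) :
  exists2 K : R, 0 <= K & forall c, rnorm (b c) <= K * \sum_i rnorm (c 0 i).
Proof.
exists (\sum_i rnorm (b (delta_mx 0 i))).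
  by apply: sumr_ge0 => i _; exact: rnorm_ge0.
move=> c; rewrite {1}[c]row_sum_delta linear_sum (le_trans (rnorm_sum _)) //.
rewrite mulr_sumr ler_sum // => i _;
  rewrite linearZ rnormZ mulrC ler_wpM2r ?rnorm_ge0 //.
by rewrite (bigD1 i) //= lerDl sumr_ge0 // => j _; exact: rnorm_ge0.
Qed.

(** Coordinates on the quotient [V / U], carried by a complement of [U]. *)
Definition complement_coords n (V U : set X) (b : {linear 'rV[R[i]]_n -> X}) :=
  [/\ forall c, V (b c), forall x, V x -> exists c, U (x - b c) &
      forall c, U (b c) -> c = 0].

(** The map [(v, c) |-> S v + b c] from [V * C^n] onto [V] is open.  Hence the
    coordinates [c] of a vector of [V] modulo [S @` V], which are well defined,
    are controlled by its distance to [S @` V]: they vanish on the closure. *)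
Lemma closed_image_finite_codim n (S : {linear X -> X}) (V : set X)
    (b : {linear 'rV[R[i]]_n -> X}) :
  bounded_op S -> subspace V -> closed V -> S @` V `<=` V ->
  complement_coords V (S @` V) b -> closed (S @` V).
Proof.
move=> /bounded_opP[K K0 SK] sV clV SV [bV bspan bfree].
have [Kb Kb0 bK] := row_linear_bound b.
pose Z := (X * 'rV[R[i]]_n)%type.
pose f0 (z : Z) := S z.1 + b z.2.
have linf : linear f0.
  by move=> a x y; rewrite /f0 /= !linearP scalerDr addrACA.
pose f : {linear Z -> X} := HB.pack f0 (GRing.isLinear.Build R[i] Z X *:%R f0
  linf).
have sZ : subspace [set z : Z | V z.1].
  by split=> [|a x y /=]; [exact: sV.1|exact: sV.2].
have fV : f @` [set z : Z | V z.1] = V.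
  apply/seteqP; split=> [_ [[x c] /= Vx <-]|x Vx].
    by apply: subspaceD => //; apply: SV; exists x.
  by have [c [y Vy yx]] := bspan _ Vx; exists (y, c) => //=;
    rewrite /f0 /= yx subrK.
have [|||||C C0 om] := @open_mapping R Z X f (@prod_seminorm n) [set z : Z | V
  z.1] (K + Kb) sZ.
- exact: prod_seminormP.
- exact: complete_prod.
- by rewrite addr_ge0 // ltW.
- move=> z; rewrite (le_trans (rnormD _ _)) // /prod_seminorm mulrDl.
  have s0 : 0 <= \sum_i rnorm (z.2 0 i).
    by rewrite sumr_ge0 // => i _; exact: rnorm_ge0.
  have := SK z.1; have := bK z.2; have := mulr_ge0 (ltW K0) s0.
  by have := mulr_ge0 Kb0 (rnorm_ge0 z.1); lra.
- by rewrite fV.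
apply/closed_rnormP => u u_lim; have Vu : V u.
  move/closed_rnormP: clV; apply=> e /u_lim[w SVw uw].
  by exists w => //; exact: SV.
have [c [v Vv vu]] := bspan _ Vu.
suff c0 : c = 0 by exists v => //; rewrite vu c0 linear0 subr0.
apply/rowP => i; rewrite mxE; apply: rnorm0_eq0; rewrite leNgt;
  apply/negP => ci.
have [|_ [w Vw <-] uw] := u_lim (rnorm (c 0 i) / C); first by rewrite divr_gt0.
have [|[v' c'] /= [Vv' f_eq Pv']] := om (v - w, c); first exact: subspaceB.
have fE : f (v - w, c) = u - S w.
  by rewrite /= /f0 /= linearB vu -addrA addrAC addrA addrAC subrK.
have cc' : c' - c = 0.
  apply: bfree; exists (v - w - v'); first by do !apply: subspaceB => //.
  move: f_eq; rewrite /= /f0 /= => f_eq; rewrite !linearB /=.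
  by apply/eqP; rewrite subr_eq addrAC eq_sym subr_eq eq_sym -linearB -f_eq
    addrC.
have {}Pv' : prod_seminorm (v', c') <= C * rnorm (u - S w) by rewrite -fE.
move: Pv'; apply/negP; rewrite -ltNge.
have {}cc' : c' = c by apply/eqP; rewrite -subr_eq0 cc'.
rewrite mulrC -ltr_pdivlMr // (lt_le_trans uw) //.
rewrite ler_pM2r ?invr_gt0 // /prod_seminorm cc' /= (bigD1 i) //= addrCA lerDl.
by rewrite addr_ge0 ?rnorm_ge0 // sumr_ge0 // => j _; exact: rnorm_ge0.
Qed.

End ClosedRange.

(** * The index of the restriction to the range *)

Section WeylRestriction.
Variables (R : realType) (X : completeNormedModType R[i]) (S : {linear X -> X}).
Local Notation C := R[i].

Definition kernel_coords m (V : set X) (e : {linear 'rV[C]_m -> X}) :=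
  [/\ forall c, V (e c) /\ S (e c) = 0, forall c, e c = 0 -> c = 0 &
      forall x, V x -> S x = 0 -> exists c, x = e c].

(** For an invariant subspace [V], the restriction of S to [V] has a kernel of
    dimension [m] and a range of codimension [k] in [V]. *)
Definition restriction_index (V : set X) m k :=
  exists (e : {linear 'rV[C]_m -> X}) (b : {linear 'rV[C]_k -> X}),
    kernel_coords V e /\ complement_coords V (S @` V) b.

(** Let [N] be the kernel of S in [V], of dimension [n], and let [A] be the
    square matrix of the map from [N] to [V / S V] induced by the inclusion.
    The kernel of [A] is the kernel of S in [S V].  The map S induces an
    isomorphism from the cokernel of [A] onto [S V / S (S V)].  Both have
    dimension [n - \rank A], and equality with [n] means [A = 0], that is,
    [N] lies in [S V]. *)
Lemma index_image n (V : set X) : subspace V -> S @` V `<=` V ->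
  restriction_index V n n ->
  exists2 m, restriction_index (S @` V) m m &
    (m <= n)%N /\ (m = n -> forall x, V x -> S x = 0 -> (S @` V) x).
Proof.
move=> sV SV [e [b [[eV einj espan] [bV bspan bfree]]]].
have sSV : subspace (S @` V) by exact: subspace_image.
have /choice[a aP] : forall i, exists a, (S @` V) (e (delta_mx 0 i) - b a).
  by move=> i; apply: bspan; have [] := eV (delta_mx 0 i).
pose A := \matrix_i a i.
have eA c : (S @` V) (e c - b (c *m A)).
  rewrite {1}[c]row_sum_delta linear_sum mulmx_sum_row linear_sum -sumrB.
  apply: subspace_sum => // i; rewrite !linearZ rowK -scalerDr.
  exact: (subspaceZ sSV _ (aP i)).
have eker c : (S @` V) (e c) <-> c *m A = 0.
  split=> [ec|cA]; last by have := eA c; rewrite cA linear0 subr0.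
  by apply: bfree; have := subspaceB sSV ec (eA c); rewrite opprB addrC subrK.
have row_freeP p q (M : 'M[C]_(p, q)) (c : 'rV_p) :
    row_free M -> c *m M = 0 -> c = 0.
  by move=> fM /eqP; rewrite -(mul0mx 1 M) (inj_eq (row_free_inj fM)) => /eqP.
pose K := row_base (kermx A); pose B := row_base (A^C)%MS.
have KA : K *m A = 0 by apply/sub_kermxP; rewrite eq_row_base.
pose e' : {linear 'rV_(\rank (kermx A)) -> X} := e \o mulmxr K.
pose b' : {linear 'rV_(\rank (A^C)%MS) -> X} := S \o b \o mulmxr B.
have krank : \rank (kermx A) = (n - \rank A)%N by exact: mxrank_ker.
have crank : \rank (A^C)%MS = \rank (kermx A) by rewrite krank mxrank_compl.
have idx : restriction_index (S @` V) (\rank (kermx A)) (\rank (A^C)%MS).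
  exists e', b'; split; split.
  - move=> c; rewrite /e' /=; split; last by have [] := eV (c *m K).
    by apply/eker; rewrite -mulmxA KA mulmx0.
  - by move=> c /einj; apply: row_freeP; exact: row_base_free.
  - move=> x SVx Sx; have [c xc] := espan _ (SV _ SVx) Sx.
    have /sub_kermxP : c *m A = 0 by apply/eker; rewrite -xc.
    rewrite -(eq_row_base (kermx A)) => /submxP[d cd].
    by exists d; rewrite xc cd.
  - by move=> c; exists (b (c *m B)).
  - move=> _ [v Vv <-]; have [c vc] := bspan _ Vv.
    have /sub_addsmxP[[u w] /= cE] : (c <= A + B)%MS.
      rewrite (adds_eqmx (eqmx_refl A) (eq_row_base _)).
      by rewrite submx_full // addsmx_compl_full.
    exists w; exists (v - b c + (b (u *m A) - e u)).
      apply: (subspaceD sSV vc); rewrite -opprB -scaleN1r.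
      exact: (subspaceZ sSV _ (eA u)).
    rewrite /b' /= linearD linearB cE linearD linearB /= linearD.
    have [_ ->] := eV u; rewrite subr0 opprD addrA addrAC subrK //.
  - move=> c [s SVs Ss].
    have [|u su] := espan (b (c *m B) - s) (subspaceB sV (bV _) (SV _ SVs)).
      by rewrite linearB Ss subrr.
    have cBA : c *m B = u *m A.
      apply/eqP; rewrite -subr_eq0; apply/eqP/bfree.
      have := subspaceD sSV SVs (eA u).
      by rewrite -su addrA (addrC s) subrK -linearB.
    have : (c *m B <= A :&: A^C)%MS.
      rewrite sub_capmx {1}cBA submxMl /= -(eq_row_base (A^C)%MS) submxMl //.
    rewrite capmx_compl submx0 => /eqP; apply: row_freeP; exact: row_base_free.
exists (\rank (kermx A)); first by rewrite crank in idx.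
rewrite krank; split; first exact: leq_subr.
move=> kn; have : \rank A = 0%N.
  by have := subKn (rank_leq_row A); rewrite kn subnn.
move=> /eqP; rewrite mxrank_eq0 => /eqP A0 x Vx Sx;
  have [c ->] := espan _ Vx Sx.
by apply/eker; rewrite A0 mulmx0.
Qed.

End WeylRestriction.

(** * Ranges of the powers of a Weyl operator *)

Section Ranges.
Variables (R : realType) (X : completeNormedModType R[i]) (S : {linear X -> X}).
Local Notation C := R[i].

Lemma range_iterS k : range (iter k.+1 S) = S @` range (iter k S).
Proof.
apply/seteqP; split=> [_ [x _ <-]|_ [_ [x _ <-] <-]].
  by exists (iter k S x) => //; exists x.
by exists x.
Qed.

Lemma subspace_range k : subspace (range (iter k S)).
Proof.
elim: k => [|k ih]; last by rewrite range_iterS; exact: subspace_image.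
by split=> [|a x y _ _]; [exists 0|exists (a *: x + y)].
Qed.

Lemma range_decr j k : (k <= j)%N -> range (iter j S) `<=` range (iter k S).
Proof.
by move=> /subnKC <- _ [x _ <-]; exists (iter (j - k) S x); rewrite // -iterD.
Qed.

Lemma range_stable k : S @` range (iter k S) `<=` range (iter k S).
Proof. by rewrite -range_iterS; exact: range_decr. Qed.

Section RowComb.
Variables (n : nat) (b : 'I_n -> X).

Definition row_comb (c : 'rV[C]_n) : X := \sum_i c 0 i *: b i.

Lemma row_comb_linear : linear row_comb.
Proof.
move=> a x y; rewrite /row_comb scaler_sumr -big_split /=.
by apply: eq_bigr => i _; rewrite !mxE scalerDl scalerA.
Qed.

HB.instance Definition _ := GRing.isLinear.Build C 'rV[C]_n X *:%R row_comb
  row_comb_linear.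

Lemma row_comb_ffun c : row_comb c = \sum_i [ffun i => c 0 i] i *: b i.
Proof. by apply: eq_bigr => i _; rewrite ffunE. Qed.

Lemma ffun_row_comb (c : {ffun 'I_n -> C}) :
  \sum_i c i *: b i = row_comb (\row_i c i).
Proof. by apply: eq_bigr => i _; rewrite mxE. Qed.

End RowComb.

Lemma weyl_restriction_index : weyl S -> exists n, restriction_index S setT n n.
Proof.
move=> [[[m dimN] [k codimR]] idx0].
have dN : has_dim (null_space S) (Defs.dim (null_space S)).
  by rewrite /Defs.dim; case: xgetP => [? -> //|/(_ m)].
have dR : has_codim (range S) (Defs.codim (range S)).
  by rewrite /Defs.codim; case: xgetP => [? -> //|/(_ k)].
have nk : Defs.codim (range S) = Defs.dim (null_space S).
  by move: idx0 => /eqP; rewrite subr_eq0 => /eqP [->].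
move: dN dR; rewrite nk; move: (Defs.dim _) => n [e eN espan] [b bspan].
exists n, (row_comb e), (row_comb b); split; split=> //.
- move=> c; split=> //=; rewrite /row_comb linear_sum big1 // => i _.
  by rewrite linearZ /= (eN i : S (e i) = 0) scaler0.
- move=> c ec; have [|d [_ duniq]] := espan 0; first exact: linear0.
  have := duniq [ffun i => c 0 i]; rewrite -row_comb_ffun ec => /(_ erefl) dc.
  have := duniq [ffun => 0]; rewrite big1 => [/(_ erefl)|i _];
    last by rewrite ffunE scale0r.
  by rewrite dc => /ffunP c0; apply/rowP => i; have := c0 i; rewrite !ffunE mxE.
- by move=> x _ /espan[d [-> _]]; exists (\row_i d i); rewrite ffun_row_comb.
- by move=> x _; have [d [Rd _]] := bspan x; exists (\row_i d i);
  rewrite /= -ffun_row_comb.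
- move=> c bc; have [d [_ duniq]] := bspan (row_comb b c).
  have := duniq [ffun i => c 0 i]; rewrite -row_comb_ffun subrr => dc.
  have {}dc : d = [ffun i => c 0 i] by apply: dc; exists 0; rewrite ?linear0.
  have := duniq [ffun => 0]; rewrite big1 => [|i _];
    last by rewrite ffunE scale0r.
  rewrite subr0 dc => /(_ bc) /ffunP c0.
  by apply/rowP => i; have := c0 i; rewrite !ffunE mxE.
Qed.

Hypothesis wS : weyl S.

Lemma range_index k : exists m, restriction_index S (range (iter k S)) m m.
Proof.
elim: k => [|k [m ih]].
  have [n] := weyl_restriction_index wS; exists n.
  by rewrite (_ : range _ = setT) //; apply/seteqP; split=> // x _; exists x.
have [m' ? _] := index_image (subspace_range k) (@range_stable k) ih.
by exists m'; rewrite range_iterS.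
Qed.

(** The dimension of the kernel of S in the successive ranges is nonincreasing.
    From the point on where it is minimal, [index_image] puts the kernel of each
    range into the next range. *)
Lemma kernel_range_stabilizes : exists K, forall j x,
  range (iter K S) x -> S x = 0 -> range (iter j S) x.
Proof.
pose Q :=
  [pred m | `[< exists k, restriction_index S (range (iter k S)) m m >]].
have exQ : exists m, Q m.
  by have [m ?] := range_index 0; exists m; apply/asboolP; exists 0%N.
case: (ex_minnP exQ) => m /asboolP[K idxK] minm; exists K.
have step k : restriction_index S (range (iter k S)) m m ->
    restriction_index S (range (iter k.+1 S)) m m /\
    forall x, range (iter k S) x -> S x = 0 -> range (iter k.+1 S) x.
  move=> idxk.
  have [m' idx' [m'm h]] := index_image (subspace_range k) (@range_stable k)
    idxk.
  have mm' : m' = m.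
    apply/eqP; rewrite eqn_leq m'm; apply: minm; apply/asboolP; exists k.+1.
    by rewrite range_iterS.
  by rewrite range_iterS; split; [rewrite mm' in idx'|exact: h].
have idx d : restriction_index S (range (iter (d + K) S)) m m.
  by elim: d => [//|d /step[]].
move=> j x Kx Sx; apply: (@range_decr (j + K) j); first exact: leq_addr.
by elim: j => [//|d ih]; have [_] := step _ (idx d); apply.
Qed.

(** A trivial kernel in an invariant subspace where S has index zero makes S
    onto there. *)
Lemma range_stationary p : (forall x, range (iter p S) x -> S x = 0 -> x = 0) ->
  range (iter p S) `<=` range (iter p.+1 S).
Proof.
move=> inj; have [m [e [b [[eN einj _] [_ bspan _]]]]] := range_index p.
have m0 : m = 0%N.
  apply/eqP; rewrite -leqn0 leqNgt; apply/negP => m0.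
  have /matrixP/(_ 0 (Ordinal m0)) : delta_mx 0 (Ordinal m0) = 0 :> 'rV[C]_m.
    by apply: einj; have [? ?] := eN (delta_mx 0 (Ordinal m0)); exact: inj.
  by rewrite !mxE !eqxx => /eqP; rewrite oner_eq0.
subst m; move=> x /bspan[c]; rewrite (thinmx0 c) linear0 subr0.
by rewrite -range_iterS.
Qed.

Hypothesis bS : bounded_op S.

Lemma closed_range_iter k : closed (range (iter k S)).
Proof.
elim: k => [|k ih].
  rewrite (_ : range _ = setT); first exact: closedT.
  by apply/seteqP; split=> // x _; exists x.
have [m [e [b [_ cb]]]] := range_index k; rewrite range_iterS.
by apply: closed_image_finite_codim cb => //;
  [exact: subspace_range|exact: range_stable].
Qed.

End Ranges.

(** * Perturbation by small scalars *)

Section IterLinear.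
Variables (R : realType) (X : lmodType R[i]) (S : {linear X -> X}) (n : nat).

Lemma iter_is_linear : linear (iter n S).
Proof. by move=> a x y; elim: n => [//|k ih] /=; rewrite ih linearP. Qed.

Definition iter_op : {linear X -> X} :=
  HB.pack (iter n S) (GRing.isLinear.Build R[i] X X *:%R (iter n S)
    iter_is_linear).

Lemma iter_add x y : iter n S (x + y) = iter n S x + iter n S y.
Proof. exact: (linearD iter_op). Qed.

Lemma iterB x y : iter n S (x - y) = iter n S x - iter n S y.
Proof. exact: (linearB iter_op). Qed.

End IterLinear.

Section ImageOpen.
Variables (R : realType) (X : completeNormedModType R[i]).

Lemma iter_bounded (S : {linear X -> X}) n : bounded_op S ->
  exists2 B : R, 0 < B & forall x, rnorm (iter n S x) <= B * rnorm x.
Proof.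
move=> /bounded_opP[K K0 SK]; exists (K ^+ n); first by rewrite exprn_gt0.
elim: n => [|n ih] x; first by rewrite mul1r.
rewrite exprS -mulrA (le_trans (SK _)) //.
exact: (ler_wpM2l (ltW K0) (ih x)).
Qed.

Lemma image_open (S : {linear X -> X}) (V : set X) :
  bounded_op S -> subspace V -> closed V -> closed (S @` V) ->
  exists2 c : R, 0 < c & forall v, V v ->
    exists v', [/\ V v', S v' = S v & rnorm v' <= c * rnorm (S v)].
Proof.
move=> bS sV clV clSV; have [K K0 SK] := bounded_opP bS.
have [|||||c c0 om] := @open_mapping R X X S (@rnorm R X) V K sV;
  last by exists c.
- exact: seminorm_rnorm.
- exact: complete_closed.
- exact: ltW.
- exact: SK.
- exact: clSV.
Qed.

Lemma iter_open (S : {linear X -> X}) n : bounded_op S ->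
  closed (range (iter n S)) -> exists2 c : R, 0 < c & forall v,
    exists2 v', iter n S v' = iter n S v & rnorm v' <= c * rnorm (iter n S v).
Proof.
move=> bS clR; have [B B0 SB] := iter_bounded n bS.
have [||||||c c0 om] := @open_mapping R X X (iter_op S n) (@rnorm R X) setT B.
- by split.
- exact: seminorm_rnorm.
- by apply: complete_closed; [split|exact: closedT].
- exact: ltW.
- exact: SB.
- exact: clR.
by exists c => // v; have [//|v' [_ ? ?]] := om v; exists v'.
Qed.

End ImageOpen.

Section Perturbation.
Variables (R : realType) (X : completeNormedModType R[i]) (S : {linear X -> X}).
Hypothesis bS : bounded_op S.
Local Notation C := R[i].

(** Neumann series: [x] is the sum of the [x_k], where [S x_k = y_k], [y_0 = m]
    and [y_(k+1) = mu *: x_k], so that the partial sums are sent to [m - y_n].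
    That [D] does not depend on [mu] is what [isolated_finite_ascent] needs. *)
Lemma onto_perturbation (M : set X) (c : R) : subspace M -> closed M ->
  (forall m, M m -> exists m', [/\ M m', S m' = m & rnorm m' <= c * rnorm m]) ->
  exists2 D : R, 0 <= D & forall mu, rnorm mu * c <= 2^-1 ->
    forall m, M m -> exists x,
      [/\ M x, S x - mu *: x = m & rnorm x <= D * rnorm m].
Proof.
move=> sM clM onto; have [A A0 cA] := complete_closed sM clM.
have [K K0 SK] := bounded_opP bS.
exists (A * `|c|) => [|mu muc m Mm]; first by rewrite mulr_ge0.
have /choice[g gP] : forall m, exists m', M m ->
    [/\ M m', S m' = m & rnorm m' <= c * rnorm m].
  move=> y; have [My|nMy] := pselect (M y); last by exists 0.
  by have [y' yP] := onto y My; exists y'.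
pose y := fix y n := if n is k.+1 then mu *: g (y k) else m : X.
have My n : M (y n).
  by elim: n => [//|n ih] /=; apply: subspaceZ => //; have [] := gP _ ih.
have yP n := gP _ (My n).
have yn n : rnorm (y n) <= rnorm m * 2^-1 ^+ n.
  elim: n => [|n ih] /=; first by rewrite mulr1.
  rewrite rnormZ; have [_ _ gy] := yP n.
  have := ler_wpM2l (rnorm_ge0 mu) gy; have := ler_wpM2r (rnorm_ge0 (y n)) muc.
  by rewrite exprS; lra.
pose x n := g (y n).
have [|n|s Ms sA] := cA x (`|c| * rnorm m).
- by move=> n; have [] := yP n.
- have [_ _ gy] := yP n; apply: (le_trans gy).
  apply: (@le_trans _ _ (`|c| * rnorm (y n))).
    by rewrite ler_wpM2r ?rnorm_ge0 // ler_norm.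
  by rewrite -mulrA ler_wpM2l.
exists s; split=> //; last first.
  by have := sA 0%N; rewrite big_ord0 subr0 mulr1 mulrA.
have sumE n : S (\sum_(k < n) x k) - mu *: \sum_(k < n) x k = m - y n.
  elim: n => [|n ih]; first by rewrite big_ord0 linear0 scaler0 !subrr.
  rewrite big_ord_recr /= linearD scalerDr opprD addrACA ih.
  by have [_ -> _] := yP n; rewrite addrA subrK.
apply/eqP; rewrite -subr_eq0; apply/eqP/rnorm0_eq0; rewrite leNgt; apply/negP.
pose B := (K + rnorm mu) * (A * (`|c| * rnorm m)) + rnorm m.
move=> /(geom_lt B)[n]; apply/negP; rewrite -leNgt.
pose d := s - \sum_(k < n) x k.
have dE : S d - mu *: d = S s - mu *: s - (m - y n).
  by rewrite -sumE linearB scalerBr !opprD !opprK addrACA.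
have -> : S s - mu *: s - m = (S d - mu *: d) - y n.
  by rewrite dE opprB (addrC (y n)) addrA addrK.
have := rnormB (S d - mu *: d) (y n); have := rnormB (S d) (mu *: d).
have := yn n; rewrite rnormZ.
have := ler_wpM2l (addr_ge0 (ltW K0) (rnorm_ge0 mu)) (sA n).
have := SK d; rewrite /B -/d; lra.
Qed.

(** [S^n - mu^n] is [S - mu] composed with a polynomial in S.  The first part
    serves surjectivity of [S - mu], the second one serves lower bounds. *)
Lemma power_shift n mu : exists2 B : R, 0 <= B & forall x, exists y,
  iter n S x - mu ^+ n *: x = S y - mu *: y /\
  rnorm (iter n S x - mu ^+ n *: x) <= B * rnorm (S x - mu *: x).
Proof.
have [K K0 SK] := bounded_opP bS.
elim: n => [|n [B B0 ih]].
  exists 0 => // x; exists 0.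
  by rewrite scale1r linear0 scaler0 !subrr rnorm0 mul0r.
exists (K * B + rnorm mu ^+ n).
  by rewrite addr_ge0 ?exprn_ge0 ?rnorm_ge0 // mulr_ge0 // ltW.
move=> x; have [y [xy xB]] := ih x.
have E : iter n.+1 S x - mu ^+ n.+1 *: x =
    S (iter n S x - mu ^+ n *: x) + mu ^+ n *: (S x - mu *: x).
  by rewrite linearB [S (_ *: _)]linearZ /= scalerBr addrA subrK scalerA exprSr.
exists (S y + mu ^+ n *: x); split.
  rewrite E xy [S (S y - _)]linearB [S (S y + _)]linearD ![S (_ *: _)]linearZ
    /=.
  by rewrite !scalerBr scalerDr opprD [RHS]addrACA !scalerA (mulrC mu).
rewrite E (le_trans (rnormD _ _)) // rnormZ rnormX mulrDl lerD //.
by rewrite (le_trans (SK _)) // -mulrA ler_wpM2l // ltW.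
Qed.

Lemma iter_shift n mu x :
  iter n S (S x - mu *: x) = S (iter n S x) - mu *: iter n S x.
Proof. by elim: n => [//|n ih] /=; rewrite ih linearB [S (_ *: _)]linearZ. Qed.

(** Finite ascent is used in the form: the kernel of S meets the range of some
    power of S trivially. *)
Lemma ascent_some p : (forall x, range (iter p S) x -> S x = 0 -> x = 0) ->
  exists q, ascent S = Some q.
Proof.
move=> inj; rewrite /ascent; case: pselect => [exn|[]];
  first by exists (ex_minn exn).
exists p; apply/asboolP/seteqP; split=> x; rewrite /null_space /=;
  last by apply: inj; exists x.
by move=> ->; exact: linear0.
Qed.

Lemma ascentP p : ascent S = Some p ->
  forall x, range (iter p S) x -> S x = 0 -> x = 0.
Proof.
rewrite /ascent; case: pselect => // exn [<-];
  case: ex_minnP => m /asboolP eqN _.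
by move=> _ [x _ <-] Sx; have : null_space (iter m S) x by rewrite eqN.
Qed.

(** On the range [M] of [S^(p+1)], S is injective, and its image is closed, so S
    is bounded below on [M] and so is [S - mu] for small [mu].  If [(S - mu) x]
    is small, then [(S - mu) S^(p+1) x] is small, hence [S^(p+1) x] is small;
    but by [power_shift] it is close to [mu^(p+1) x], so [x] is small. *)
Lemma left_pole_bounded_below p :
  ascent S = Some p -> closed (range (iter p.+1 S)) ->
  exists2 eps : R, 0 < eps & forall mu, 0 < rnorm mu -> rnorm mu < eps ->
    exists2 c : R, 0 < c & forall x, c * rnorm x <= rnorm (S x - mu *: x).
Proof.
move=> /ascentP inj clM; set M := range _ in clM.
have sM : subspace M by exact: subspace_range.
have injM m : M m -> S m = 0 -> m = 0.
  by move=> /(range_decr (leqnSn p)); exact: inj.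
have injp x y : iter p.+1 S x = iter p.+1 S y -> iter p S x = iter p S y.
  move=> Sxy; apply/eqP; rewrite -subr_eq0 -iterB.
  apply/eqP/inj; first by exists (x - y).
  by rewrite -iterS iterB Sxy subrr.
(* Let [S m] be close to [z = S^(p+1) w].  Openness of [S^(p+1)] gives a small
   [v] with [S^(p+1) (w + v) = S m]; by finite ascent [S^p (w + v)] lies in [M],
   and it is close to [S^p w].  So [S^p w] lies in [M] and [z] in [S M]. *)
have clSM : closed (S @` M).
  apply/closed_rnormP => z z_lim.
  have [w _ wz] : M z.
    move/closed_rnormP: clM; apply=> e /z_lim[_ [m Mm <-] zm].
    by exists (S m) => //; apply: range_stable; exists m.
  suff : M (iter p S w) by exists (iter p S w); rewrite // -wz.
  move/closed_rnormP: (clM); apply=> e e0.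
  have [B B0 SB] := iter_bounded p bS.
  have [c c0 om] := iter_open bS clM.
  have Bc : 0 < B * c by rewrite mulr_gt0.
  have [|_ [_ [y _ <-] <-] zy] := z_lim (e / (B * c));
    first by rewrite divr_gt0.
  have [v] := om (S y - w).
  have -> : iter p.+1 S (S y - w) = S (iter p.+1 S y) - z by rewrite iterB -wz
    -iterSr.
  move=> vE vc.
  have wv : iter p S (w + v) = iter p.+1 S y.
    rewrite iterSr; apply: injp; rewrite iter_add vE wz addrC subrK.
    by rewrite -iterS iterSr.
  exists (iter p S (w + v)); first by rewrite wv; exists y.
  rewrite -iterB opprD addrA subrr sub0r.
  rewrite (le_lt_trans (SB _)) // rnormN (@le_lt_trans _ _ (B * c * rnorm (z -
    S (iter p.+1 S y)))) //.
    rewrite -mulrA rnorm_distC.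
    exact: (ler_wpM2l (ltW B0) vc).
  by rewrite mulrC -ltr_pdivlMr //; exact: zy.
have [c c0 om] := image_open bS sM clM clSM.
have below m : M m -> rnorm m <= c * rnorm (S m).
  move=> Mm; have [m' [Mm' Sm' cm']] := om _ Mm.
  suff mm' : m = m' by rewrite -mm' in cm'.
  apply/eqP; rewrite -subr_eq0; apply/eqP/injM; first exact: subspaceB.
  by rewrite linearB Sm' subrr.
have [B B0 SB] := iter_bounded p.+1 bS.
exists (2^-1 / c); first by rewrite divr_gt0 ?invr_gt0.
move=> mu mu0 muc; have [D D0 pD] := power_shift p.+1 mu.
have mup : 0 < rnorm mu ^+ p.+1 by rewrite exprn_gt0.
have cB0 : 0 < 2 * c * B + D by rewrite ltr_wpDr // !mulr_gt0.
exists (rnorm mu ^+ p.+1 / (2 * c * B + D)) => [|x]; first by rewrite divr_gt0.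
rewrite mulrAC ler_pdivrMr // -rnormX -rnormZ.
have [y [_ xD]] := pD x.
have MI : M (iter p.+1 S x) by exists x.
have IB : rnorm (iter p.+1 S x) <= 2 * c * B * rnorm (S x - mu *: x).
  have := SB (S x - mu *: x); rewrite iter_shift.
  move: (iter p.+1 S x) (below _ MI) => m mc.
  have := rnormB (S m - mu *: m) (- (mu *: m));
    rewrite opprK subrK rnormN rnormZ.
  have : rnorm mu * c * rnorm m <= 2^-1 * rnorm m.
    by rewrite ler_wpM2r ?rnorm_ge0 // -ler_pdivlMr // ltW.
  set d := rnorm (S x - _); set d' := rnorm (S m - _) => h1 h2 h3.
  have := ler_wpM2l (ltW c0) h3; have := ler_wpM2l (ltW c0) h2; lra.
have := rnormB (iter p.+1 S x) (iter p.+1 S x - mu ^+ p.+1 *: x).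
by rewrite opprB addrC subrK; lra.
Qed.

(** S maps the range [M] of [S^p] onto itself, and so does [S - mu] for small
    [mu].  Modulo the range of [S - mu], a vector [x] is a multiple of [S^p x],
    which lies in [M], hence in that range. *)
Lemma weyl_shift_onto p :
  weyl S -> (forall x, range (iter p S) x -> S x = 0 -> x = 0) ->
  exists2 eps : R, 0 < eps & forall mu, 0 < rnorm mu -> rnorm mu < eps ->
    forall x, exists y, S y - mu *: y = x.
Proof.
move=> wS inj; set M := range (iter p S).
have sM : subspace M by exact: subspace_range.
have clM : closed M by exact: closed_range_iter.
have MS m : M m -> exists2 m', M m' & S m' = m.
  by move=> /(range_stationary wS inj); rewrite range_iterS => -[m' ? ?];
    exists m'.
have [|c c0 om] := image_open bS sM clM.
  by rewrite -range_iterS; exact: closed_range_iter.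
have [|D D0 pert] := @onto_perturbation M c sM clM.
  move=> m /MS[v Mv vm]; have [v' [? ? ?]] := om _ Mv; exists v'.
  by rewrite -vm.
exists (2^-1 / c) => [|mu mu0 muc x]; first by rewrite divr_gt0 ?invr_gt0.
have [||m [_ mE _]] := pert mu _ (iter p S x) _.
- by rewrite -ler_pdivlMr // ltW.
- by exists x.
have [B _ pB] := power_shift p mu; have [y [yE _]] := pB x.
have mup : mu ^+ p != 0.
  by rewrite expf_neq0 //; apply: contraTneq mu0 => ->; rewrite rnorm0 ltxx.
exists ((mu ^+ p)^-1 *: (m - y)).
have my : S (m - y) - mu *: (m - y) = mu ^+ p *: x.
  rewrite [S (m - y)]linearB scalerBr opprD addrACA -opprD mE -yE.
  by rewrite opprB addrC subrK.
rewrite [S _]linearZ /= (scalerA mu) mulrC -scalerA -scalerBr my scalerA.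
by rewrite mulVf // scale1r.
Qed.

(** On the intersection [M] of the ranges, S and its small perturbations are
    onto with uniformly bounded preimages.  Injectivity of [S - mu] turns this
    into a lower bound for [S - mu] on [M] that is uniform in [mu] and thus
    persists at [mu = 0]. *)
Lemma isolated_finite_ascent (eps : R) : weyl S -> 0 < eps ->
  (forall mu, 0 < rnorm mu -> rnorm mu < eps ->
    forall x, S x - mu *: x = 0 -> x = 0) ->
  exists p, forall x, range (iter p S) x -> S x = 0 -> x = 0.
Proof.
move=> wS eps0 inj; have [K stab] := kernel_range_stabilizes wS.
pose M : set X := [set x | forall j, range (iter j S) x].
have sM : subspace M.
  split=> [j|a x y Mx My j]; first exact: (subspace_range S j).1.
  exact: (subspace_range S j).2.
have clM : closed M.
  rewrite (_ : M = \bigcap_j range (iter j S)); last first.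
    by apply/seteqP; split=> [x Mx j _|x Mx j]; exact: Mx.
  by apply: closed_bigI => j _; exact: closed_range_iter.
have [||c c0 om] := image_open bS (subspace_range S K).
- exact: closed_range_iter.
- by rewrite -range_iterS; exact: closed_range_iter.
have onto m : M m -> exists m', [/\ M m', S m' = m & rnorm m' <= c * rnorm m].
  move=> Mm; have := Mm K.+1; rewrite range_iterS => -[v Kv vm].
  have [v' [Kv' v'v cv']] := om _ Kv; exists v'; rewrite -vm; split=> // j.
  (* The preimage [v'] differs from a preimage [z] in a far range by a vector of
     the kernel in the [K]-th range, which lies in all the ranges. *)
  have := Mm (maxn j K).+1; rewrite range_iterS => -[z Rz zm].
  have zj := range_decr (leq_maxl j K) Rz;
    have zK := range_decr (leq_maxr j K) Rz.
  rewrite -(subrK z v'); apply: (subspaceD (subspace_range S j)) => //.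
  apply: stab; first exact: (subspaceB (subspace_range S K)).
  by rewrite linearB v'v vm zm subrr.
have [D D0 pert] := onto_perturbation sM clM onto.
exists K => x Kx Sx; have Mx : M x by move=> j; exact: stab.
(* Small enough for [S - a] to be injective, for [pert] to apply, and for
   [rnorm x <= D * a * rnorm x] to force [x = 0]. *)
pose a := Num.min (eps / 2) (Num.min (2^-1 / c) (2^-1 / (D + 1))).
have a0 : 0 < a by rewrite !lt_min !divr_gt0 ?invr_gt0 // ltr_wpDl.
have aE : rnorm (a%:C : R[i]) = a by rewrite rnorm_real gtr0_norm.
have a1 : a <= eps / 2 by rewrite /a ge_min lexx.
have a2 : a <= 2^-1 / c by rewrite /a !ge_min lexx orbT.
have a3 : a <= 2^-1 / (D + 1) by rewrite /a !ge_min lexx !orbT.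
have [||y [_ yE yD]] := pert a%:C _ (S x - a%:C *: x) _.
- by rewrite aE -ler_pdivlMr.
- by rewrite Sx sub0r -scaleN1r; exact: (subspaceZ sM _ (subspaceZ sM _ Mx)).
(* [x] is itself a preimage of [S x - a x], and the only one, so the bound on
   [y] applies to [x]. *)
have xy : y = x.
  apply/eqP; rewrite -subr_eq0; apply/eqP; apply: (inj a%:C).
  - by rewrite aE.
  - by rewrite aE; lra.
  - rewrite [S (y - x)]linearB scalerBr -(subrr (S x - a%:C *: x)) -{1}yE.
    by rewrite !opprD !opprK addrACA.
move: yD; rewrite xy Sx sub0r rnormN rnormZ aE => xD.
have aD : a * (D + 1) <= 2^-1 by rewrite -ler_pdivlMr // ltr_wpDl.
apply: rnorm0_eq0; have := ler_wpM2r (rnorm_ge0 x) aD.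
by have := mulr_ge0 (ltW a0) (rnorm_ge0 x); lra.
Qed.

End Perturbation.

(** * Spectra and left poles *)

Section Spectra.
Variables (R : realType) (X : completeNormedModType R[i]).
Implicit Types S T : {linear X -> X}.

Lemma bounded_belowP S :
  bounded_below S <->
  exists2 c : R, 0 < c & forall x, c * rnorm x <= rnorm (S x).
Proof.
split=> [[c c0 Sc]|[c c0 Sc]].
  have cE := esym (gt0_real c0).
  exists (complex.Re c); first by rewrite -ltcR -cE.
  by move=> x; rewrite -lecR rmorphM /= !rnormE -cE.
exists (c%:C); first by rewrite ltcR.
by move=> x; rewrite -!rnormE -rmorphM lecR.
Qed.

Lemma invertible_bounded_below S : invertible_op S -> bounded_below S.
Proof.
move=> [S' [/bounded_opP[K K0 S'K] SK _]]; apply/bounded_belowP.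
exists K^-1 => [|x]; first by rewrite invr_gt0.
by rewrite ler_pdivrMl // -{1}(SK x).
Qed.

Lemma onto_invertible S : bounded_below S -> (forall x, exists y, S y = x) ->
  invertible_op S.
Proof.
move=> /bounded_belowP[c c0 Sc] /choice[g gK].
have Sinj x y : S x = S y -> x = y.
  move=> /eqP; rewrite -subr_eq0 -linearB => /eqP Sxy; apply/eqP;
    rewrite -subr_eq0.
  by apply/eqP/rnorm0_eq0;
    rewrite -(pmulr_rle0 _ c0) (le_trans (Sc _)) // Sxy rnorm0.
have gl : linear g by move=> a x y; apply: Sinj; rewrite linearP !gK.
pose S' : {linear X -> X} := HB.pack g (GRing.isLinear.Build R[i] X X *:%R g
  gl).
exists S'; split=> [|x|x] /=; last exact: gK.
- exists (c^-1)%:C => x; rewrite -!rnormE -rmorphM lecR ler_pdivlMl //.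
  by rewrite (le_trans (Sc _)) // gK.
- by apply: Sinj; rewrite gK.
Qed.

Lemma injective_bounded_below S :
  bounded_op S -> (forall x, S x = 0 -> x = 0) -> closed (range S) ->
    bounded_below S.
Proof.
move=> bS injS clR; have [c c0 om] := @iter_open R X S 1 bS clR.
apply/bounded_belowP; exists c^-1 => [|x]; first by rewrite invr_gt0.
rewrite ler_pdivrMl //; have [y /= /eqP] := om x.
by rewrite -subr_eq0 -linearB => /eqP/injS/eqP; rewrite subr_eq0 => /eqP ->.
Qed.

Lemma shift_opE T lambda x : shift_op T lambda x = T x - lambda *: x.
Proof. by []. Qed.

Lemma shift_opD T lambda mu x :
  shift_op T (lambda + mu) x = shift_op T lambda x - mu *: x.
Proof. by rewrite !shift_opE scalerDl opprD addrA. Qed.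

Lemma shift_op_bounded T lambda :
  bounded_op T -> bounded_op (shift_op T lambda).
Proof.
move=> [K TK]; exists (K + `|lambda|) => x.
by rewrite shift_opE (le_trans (ler_normB _ _)) // mulrDl normrZ lerD.
Qed.

Lemma isoP (A : set R[i]) lambda : iso A lambda <->
  A lambda /\ exists2 eps : R, 0 < eps &
    forall mu, 0 < rnorm mu -> rnorm mu < eps -> ~ A (lambda + mu).
Proof.
split=> [[/set_mem Al [V /nbhs_ballP[e /= e0 eV] VA]]|[Al [eps eps0 nA]]].
  have eE := esym (gt0_real e0).
  split=> //; exists (complex.Re e) => [|mu mu0 mue Amu];
    first by rewrite -ltcR -eE.
  have : (V `&` A) (lambda + mu).
    split=> //; apply: eV; rewrite -ball_normE /= opprD addNKr normrN.
    by rewrite eE -rnormE ltcR.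
  rewrite VA /= => /eqP; rewrite -subr_eq0 addrAC subrr add0r => /eqP mu00.
  by move: mu0; rewrite mu00 rnorm0 ltxx.
split; first exact/mem_set.
exists (ball (lambda : R[i]^o) (eps%:C : R[i])); first by apply: nbhsx_ballx;
  rewrite ltcR.
apply/seteqP; split=> [z [zb Az]|_ ->]; last first.
  by split=> //; apply: ballxx; rewrite ltcR.
apply: contrapT => zl; apply: (nA (z - lambda)).
- by apply: rnorm_gt0; rewrite subr_eq0; apply/eqP.
- by move: zb; rewrite -ball_normE /= -rnormE ltcR rnorm_distC.
- by rewrite addrC subrK.
Qed.

Lemma point_spectrumP T lambda : point_spectrum T lambda <->
  exists2 x, x != 0 & shift_op T lambda x = 0.
Proof.
split=> -[x x0]; first by move=> Tx; exists x; rewrite // shift_opE Tx subrr.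
by move=> /eqP; rewrite shift_opE subr_eq0 => /eqP Tx; exists x.
Qed.

Lemma point_approx T : point_spectrum T `<=` approx_point_spectrum T.
Proof.
move=> lambda /point_spectrumP[x x0 Sx] /bounded_belowP[c c0 Sc].
move: (rnorm_gt0 x0); apply/negP; rewrite -leNgt.
by rewrite -(pmulr_rle0 _ c0) (le_trans (Sc _)) // Sx rnorm0.
Qed.

Lemma approx_spectrum T : approx_point_spectrum T `<=` spectrum T.
Proof. by move=> lambda nb /invertible_bounded_below. Qed.

Lemma iso_eigenvalues_approx T :
  iso_eigenvalues T `<=` iso_approx_eigenvalues T.
Proof.
move=> lambda [/isoP[_ [eps eps0 nA]] pl]; split=> //; apply/isoP; split.
  exact: point_approx.
by exists eps => // mu mu0 mue /approx_spectrum; exact: nA.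
Qed.

Variables (T : {linear X -> X}) (bT : bounded_op T).

(** If the ascent were zero, S would be injective with closed range, hence
    bounded below; so a left pole is an eigenvalue. *)
Lemma left_poles_iso : left_poles T `<=` iso_approx_eigenvalues T.
Proof.
move=> lambda [al [p ap clp]].
have bS := shift_op_bounded lambda bT;
  set S := shift_op T lambda in ap clp bS *.
have inj := ascentP ap.
have [eps eps0 bb] := left_pole_bounded_below bS ap clp.
split; last first.
  apply/point_spectrumP; apply: contrapT => nx; apply: al.
  have injS x : S x = 0 -> x = 0.
    by move=> Sx; apply: contrapT => /eqP x0; apply: nx; exists x.
  have p0 : p = 0%N.
    move: ap; rewrite /ascent; case: pselect => // exn [<-].
    case: ex_minnP => m _ /(_ 0%N) min0; apply/eqP; rewrite -leqn0; apply: min0.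
    by apply/asboolP/seteqP; split=> x; rewrite /null_space /=; [move=> ->;
      exact: (linear0 S)|exact: injS].
  by rewrite p0 in clp; exact: injective_bounded_below.
apply/isoP; split=> //; exists eps => // mu mu0 mue; apply.
have [c c0 bc] := bb _ mu0 mue; apply/bounded_belowP; exists c => // x.
by rewrite shift_opD.
Qed.

Lemma weyl_iso_approx_left_pole lambda : weyl (shift_op T lambda) ->
  iso_approx_eigenvalues T lambda -> left_poles T lambda.
Proof.
move=> wl [/isoP[al [eps eps0 nA]] _]; split=> //.
have bS := shift_op_bounded lambda bT.
have [|p inj] := isolated_finite_ascent bS wl eps0.
  move=> mu mu0 mue x Sx; apply: contrapT => /eqP x0.
  apply: (nA _ mu0 mue); apply: point_approx; apply/point_spectrumP.
  by exists x; rewrite // shift_opD.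
by have [q aq] := ascent_some inj; exists q => //; exact: closed_range_iter.
Qed.

Lemma weyl_left_pole_iso lambda : weyl (shift_op T lambda) ->
  left_poles T lambda -> iso_eigenvalues T lambda.
Proof.
move=> wl lp; have [_ pl] := left_poles_iso lp; split=> //.
have [al [p ap clp]] := lp; have bS := shift_op_bounded lambda bT.
have [e1 e10 bb] := left_pole_bounded_below bS ap clp.
have [e2 e20 onto] := weyl_shift_onto bS wl (ascentP ap).
apply/isoP; split; first exact: approx_spectrum.
exists (Num.min e1 e2) => [|mu mu0]; first by rewrite lt_min e10.
rewrite lt_min => /andP[mu1 mu2]; apply; apply: onto_invertible.
  have [c c0 bc] := bb _ mu0 mu1; apply/bounded_belowP; exists c => // x.
  by rewrite shift_opD.
by move=> x; have [y <-] := onto _ mu0 mu2 x; exists y; rewrite shift_opD.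
Qed.

End Spectra.

(** * The equivalence *)

Theorem corollary2p5 (R : realType) (X : completeNormedModType R[i])
    (infX : ~ finite_dim [set: X]) (T : {linear X -> X}) (bT : bounded_op T) :
  [<-> property_ZEa T;
       property_ZPia T /\ iso_approx_eigenvalues T = left_poles T;
       property_k T /\ iso_approx_eigenvalues T = iso_eigenvalues T].
Proof.
rewrite /property_ZEa /property_ZPia /property_k.
tfae.
- move=> ZEa; have EaPia : iso_approx_eigenvalues T = left_poles T.
    apply/seteqP; split; last exact: left_poles_iso.
    move=> l El; have : (spectrum T `\` weyl_spectrum T) l by rewrite ZEa.
    by move=> [_ /contrapT wl]; exact: weyl_iso_approx_left_pole.
  by rewrite ZEa EaPia.
- move=> [ZPia EaPia]; have EaE : iso_approx_eigenvalues T = iso_eigenvalues T.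
    apply/seteqP; split; last exact: iso_eigenvalues_approx.
    move=> l; rewrite EaPia => Pl.
    have : (spectrum T `\` weyl_spectrum T) l by rewrite ZPia.
    by move=> [_ /contrapT wl]; exact: weyl_left_pole_iso.
  by rewrite ZPia -EaPia EaE.
- by move=> [-> ->].
Qed.
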